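(* Suppose $\Pi$ and $\Pi'$ are chosen, for one of the following items (a)–(e), as any member of the list for $\Pi$ and any member of the list for $\Pi'$ in that same item: (a) $\Pi$: $\{132,213\},\{132,312\},\{213,231\},\{231,312\}$; $\Pi'$: $\{132,231\},\{132,312\},\{213,231\},\{213,312\}$. (b) $\Pi$: $\{132,213,231\},\{132,231,312\}$; $\Pi'$: $\{132,231,312\},\{213,231,312\}$. (c) $\Pi$: $\{132,213,312\},\{213,231,312\}$; $\Pi'$: $\{132,213,231\},\{132,213,312\}$. (d) $\Pi$: $\{123,132,312\},\{123,213,231\},\{123,231,312\}$; $\Pi'$: $\{123,132,231\},\{123,132,312\},\{123,213,231\},\{123,213,312\}$. (e) $\Pi$: $\{132,213,321\},\{132,312,321\},\{213,231,321\}$; $\Pi'$: $\{132,231,321\},\{132,312,321\},\{213,231,321\},\{213,312,321\}$. Then for all $n\ge0$, if $S=\mathrm{Av}_n(\Pi)$ and $T=\mathrm{Av}_n(\Pi')$, the pair $(S,T)$ is a Mahonian pair.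
   Context: $\mathfrak S_n$ is the set of permutations $\sigma=a_1a_2\ldots a_n$ of $[n]$ in one-line notation ($\mathfrak S_0$ consists of the empty permutation). A permutation $\sigma$ avoids $\pi\in\mathfrak S_k$ if no subsequence of $\sigma$ is order isomorphic to $\pi$ (has its entries in the same relative order as $\pi$). For a set $\Pi$ of permutations, $\mathrm{Av}_n(\Pi)$ is the set of $\sigma\in\mathfrak S_n$ avoiding every element of $\Pi$. For a word $\sigma=a_1\ldots a_n$ of nonnegative integers, $\mathrm{inv}\,\sigma=\#\{(i,j): i<j,\ a_i>a_j\}$ and $\mathrm{maj}\,\sigma=\sum_{i:\,a_i>a_{i+1}} i$. For finite sets $S,T$ of such words, $(S,T)$ is a Mahonian pair if the distribution of maj over $S$ equals the distribution of inv over $T$, i.e. $\sum_{s\in S}q^{\mathrm{maj}\,s}=\sum_{t\in T}q^{\mathrm{inv}\,t}$. *)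

(* Defs.v *)
From mathcomp Require Import all_boot all_order all_algebra.
From mathcomp Require Import finmap.

Set Implicit Arguments.
Unset Strict Implicit.
Unset Printing Implicit Defensive.

Import GRing.Theory.

Local Open Scope nat_scope.
Local Open Scope fset_scope.

(* A word of nonnegative integers; letters are indexed from 0 by [nth]. *)
Definition word := seq nat.

Definition inv (s : word) : nat :=
  #|[set ij : 'I_(size s) * 'I_(size s) |
      (ij.1 < ij.2) && (nth 0 s ij.1 > nth 0 s ij.2)]|.

(* A descent between the 0-based positions i and i.+1 contributes i.+1, its
   1-based position. *)
Definition maj (s : word) : nat :=
  \sum_(i < (size s).-1 | nth 0 s i > nth 0 s i.+1) i.+1.

Definition order_isomorphic (u v : word) : bool :=
  (size u == size v) &&
  [forall i : 'I_(size u), forall j : 'I_(size u),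
     (nth 0 u i < nth 0 u j) == (nth 0 v i < nth 0 v j)].

(* The subsequences of s are the words [mask m s]; see [containsP]. *)
Definition contains (p s : word) : bool :=
  [exists m : (size s).-tuple bool, order_isomorphic (mask m s) p].

Lemma containsP (p s : word) :
  reflect (exists2 u, subseq u s & order_isomorphic u p) (contains p s).
Proof.
apply: (iffP existsP) => [[m iso_m] | [u /subseqP[m sz_m ->] iso_u]].
  by exists (mask m s); rewrite ?mask_subseq.
by exists (Tuple (introT eqP sz_m)).
Qed.

Definition avoids (s p : word) : bool := ~~ contains p s.

(* The permutations of {1, ..., n}, in one-line notation. *)
Definition Sym (n : nat) : {fset word} := [fset s in permutations (iota 1 n)].

Definition Av (n : nat) (Pi : {fset word}) : {fset word} :=
  [fset s in Sym n | all (avoids s) Pi].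

Definition mahonian_pair (S T : {fset word}) : Prop :=
  (\sum_(s <- S) 'X^(maj s) = \sum_(t <- T) 'X^(inv t) :> {poly int})%R.

Definition p123 : word := [:: 1; 2; 3].
Definition p132 : word := [:: 1; 3; 2].
Definition p213 : word := [:: 2; 1; 3].
Definition p231 : word := [:: 2; 3; 1].
Definition p312 : word := [:: 3; 1; 2].
Definition p321 : word := [:: 3; 2; 1].

(* Main.v *)
From mathcomp Require Import all_boot all_order all_algebra.
From mathcomp Require Import finmap zify.
Require Import Defs.

(** Let Av_n be one of the two sets S and T.  For n > 0 every permutation of
    [n+1] in Av_(n+1) arises from one permutation w in Av_n by one of two
    insertions, f0 or f1: f0 leaves the statistic unchanged and f1 raises it
    by n.  If Q_n is the generating function of the statistic over Av_n, and
    both insertions are always allowed, then Q_(n+1) = (1 + q^n) Q_n, whichever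
    set and statistic one started from.

    For inv, f0 puts a new maximum last or a new minimum first, and f1 puts a
    new maximum first or a new minimum last.  Each set for inv in item (a)
    is generated by one of the two choices for f0 and one of the two for f1
    ([grows_inv]).

    For maj, both insertions append a letter v to w and shift up the letters
    that are at least v.  If k is the last letter of w, then v <= k makes a
    descent at position n and v > k makes none.  Avoiding 132 or 231 leaves a
    single v <= k, namely 1 or k; avoiding 312 or 213 leaves a single v > k,
    namely n+1 or k+1 ([last_letter_cover]).  So again there are two insertions
    per word, with the required effect on maj.

    A third pattern is compatible with one of the insertions and allows the
    other only on a monotone word w, increasing or decreasing according to the
    item.  The monotone permutation of that kind lies in both S and T and has
    maj w = inv w, so the recurrences for maj and inv have the same correction
    term ([tame_gen_fun]), and induction on n ends the proof
    ([family_mahonian]). *)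

Set Implicit Arguments.
Unset Strict Implicit.

Local Open Scope nat_scope.

(** * The statistics maj and inv under insertion of an end letter *)

Lemma inv_sum s :
  inv s = \sum_(i < size s) \sum_(j < size s)
            ((i < j) && (nth 0 s i > nth 0 s j) : nat).
Proof.
rewrite /inv -sum1_card pair_big big_mkcond /=.
by apply: eq_bigr => -[i j] _; rewrite inE /=; case: (_ && _).
Qed.

Lemma sum_nth_count (a : pred nat) s :
  \sum_(i < size s) (a (nth 0 s i) : nat) = count a s.
Proof.
rewrite -sum1_count (big_nth 0) big_mkord [RHS]big_mkcond.
by apply: eq_bigr => i _; case: (a _).
Qed.

Lemma inv_cons x s : inv (x :: s) = inv s + count (ltn^~ x) s.
Proof.
rewrite !inv_sum /= big_ord_recl addnC; congr (_ + _).
  apply: eq_bigr => i _; rewrite big_ord_recl /=.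
  by apply: eq_bigr => j _.
rewrite big_ord_recl /= add0n -sum_nth_count.
by apply: eq_bigr => j _.
Qed.

Lemma inv_rcons s x : inv (rcons s x) = inv s + count (leq x.+1) s.
Proof.
rewrite !inv_sum size_rcons big_ord_recr /=.
rewrite [X in _ + X]big1 => [|j _]; last first.
  by rewrite [_ < j]ltnNge -ltnS ltn_ord.
rewrite addn0 -sum_nth_count -big_split; apply: eq_bigr => i _.
rewrite big_ord_recr /= !nth_rcons ltnn eqxx ltn_ord /=; congr (_ + _).
by apply: eq_bigr => j _; rewrite nth_rcons !ltn_ord.
Qed.

Lemma inv_map f s : {mono f : x y / x < y} -> inv (map f s) = inv s.
Proof.
move=> mono_f; elim/last_ind: s => [|s x IHs]; first by [].
rewrite map_rcons !inv_rcons IHs count_map; congr (_ + _).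
by apply: eq_count => y /=; rewrite mono_f.
Qed.

Lemma maj_rcons s x : maj (rcons s x) = maj s + (x < last 0 s) * size s.
Proof.
case: s => [|y s]; first by rewrite /maj /= !big_ord0 muln0.
rewrite /maj size_rcons /= big_mkcond big_ord_recr /= -big_mkcond.
rewrite -rcons_cons !nth_rcons /= ltnn eqxx ltnSn nth_last /=.
congr (_ + _); last by case: ifP; rewrite ?mul1n.
apply: eq_bigl => i.
by rewrite -rcons_cons !nth_rcons /= ltnS ltn_ord (ltnW (ltn_ord i)).
Qed.

Lemma maj_map f s : {mono f : x y / x < y} -> maj (map f s) = maj s.
Proof.
move=> mono_f; elim/last_ind: s => [|s x IHs]; first by [].
rewrite map_rcons !maj_rcons IHs size_map; congr (_ + _).
by case: s {IHs} => [|y s] //=; rewrite last_map mono_f.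
Qed.

(** * Monotone words *)

Lemma sorted_subseqP {r : rel nat} (tr : transitive r) s :
  reflect (forall a b, subseq [:: a; b] s -> r a b) (sorted r s).
Proof.
rewrite (sorted_pairwise tr); apply: (iffP idP) => [|H].
  elim: s => // x s IHs /= /andP[/allP r_x /IHs{}IHs] a b.
  by case: eqP => [->|_ /IHs//]; rewrite sub1seq => /r_x.
elim: s H => //= x s IHs H; apply/andP; split; last first.
  by apply: IHs => a b ab; apply: H; case: eqP => // _; apply: cons_subseq ab.
by apply/allP => b bs; apply: (H x b); rewrite eqxx sub1seq.
Qed.

Notation increasing := (sorted ltn).
Notation decreasing := (sorted gtn).

Lemma gtn_trans : transitive gtn.
Proof. by move=> y x z /= yx zy; apply: ltn_trans zy yx. Qed.

Definition increasingP := sorted_subseqP ltn_trans.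
Definition decreasingP := sorted_subseqP gtn_trans.

(** Both statistics vanish. *)
Lemma increasing_maj_inv s : increasing s -> maj s = inv s.
Proof.
elim/last_ind: s => [|s x IHs] inc_s; first by rewrite /maj inv_sum !big_ord0.
move: inc_s; rewrite (sorted_pairwise ltn_trans) pairwise_rcons => /andP[lt_x].
rewrite -(sorted_pairwise ltn_trans) => /IHs{}IHs.
rewrite maj_rcons inv_rcons IHs (@eq_in_count _ _ pred0) ?count_pred0.
  case: s lt_x {IHs} => [|y s] // /allP lt_x.
  by rewrite /= ltnNge ltnW ?lt_x ?mem_last.
by move=> y /(allP lt_x) /=; lia.
Qed.

(** Appending a letter below all n letters of a word adds n to both
    statistics: one descent at position n, and n inversions. *)
Lemma decreasing_maj_inv s : decreasing s -> maj s = inv s.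
Proof.
elim/last_ind: s => [|s x IHs] dec_s; first by rewrite /maj inv_sum !big_ord0.
move: dec_s; rewrite (sorted_pairwise gtn_trans) pairwise_rcons => /andP[gt_x].
rewrite -(sorted_pairwise gtn_trans) => /IHs{}IHs.
rewrite maj_rcons inv_rcons IHs (eqP (_ : count _ s == size s)).
  case: s gt_x {IHs} => [|y s] // /allP gt_x /=.
  by have /= -> := gt_x _ (mem_last y s); rewrite mul1n.
by rewrite -all_count.
Qed.

(** * Occurrences of three-letter patterns *)

Lemma order_isomorphic3 a b c x y z :
  order_isomorphic [:: a; b; c] [:: x; y; z] =
    [&& (a < b) == (x < y), (b < a) == (y < x), (a < c) == (x < z),
        (c < a) == (z < x), (b < c) == (y < z) & (c < b) == (z < y)].
Proof.
rewrite /order_isomorphic /=; apply/forallP/idP => [H | H i].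
  pose t (i j : 'I_3) := eqP (forallP (H i) j).
  move: (t (@Ordinal 3 0 isT) (@Ordinal 3 1 isT)) => /= ->.
  move: (t (@Ordinal 3 1 isT) (@Ordinal 3 0 isT)) => /= ->.
  move: (t (@Ordinal 3 0 isT) (@Ordinal 3 2 isT)) => /= ->.
  move: (t (@Ordinal 3 2 isT) (@Ordinal 3 0 isT)) => /= ->.
  move: (t (@Ordinal 3 1 isT) (@Ordinal 3 2 isT)) => /= ->.
  move: (t (@Ordinal 3 2 isT) (@Ordinal 3 1 isT)) => /= ->.
  by rewrite !eqxx.
case/and5P: H => h1 h2 h3 h4 /andP[h5 h6].
apply/forallP => j; case: i j => [[|[|[|//]]] ?] [[|[|[|//]]] ?] //=;
  by rewrite ?ltnn.
Qed.

Lemma order_isomorphic_map f u p :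
  {mono f : x y / x < y} -> order_isomorphic (map f u) p = order_isomorphic u p.
Proof.
move=> mono_f; rewrite /order_isomorphic size_map; congr (_ && _).
apply: eq_forallb => i; apply: eq_forallb => j.
by rewrite !(nth_map 0) ?mono_f.
Qed.

Lemma avoids_not_iso s p u :
  avoids s p -> subseq u s -> ~~ order_isomorphic u p.
Proof. by move=> av us; apply: contra av => iso; apply/containsP; exists u. Qed.

Lemma avoidsP p s : size p = 3 ->
  reflect (forall a b c, subseq [:: a; b; c] s ->
             ~~ order_isomorphic [:: a; b; c] p) (avoids s p).
Proof.
move=> p3; apply: (iffP idP) => [av a b c abc | H].
  exact: avoids_not_iso abc.
apply/containsP => -[u us iso]; have /andP[/eqP] := iso; rewrite p3.
by case: u us iso => [|a [|b [|c []]]] // us iso _ _; case/negP: (H _ _ _ us).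
Qed.

Lemma avoids_subseq s t p : subseq s t -> avoids t p -> avoids s p.
Proof.
move=> st; apply: contra => /containsP[u us iso].
by apply/containsP; exists u => //; apply: subseq_trans st.
Qed.

Lemma subseq_map_inv (f : nat -> nat) s u :
  subseq u (map f s) -> exists2 t, subseq t s & u = map f t.
Proof.
case/subseqP=> m _ ->; exists (mask m s); last by rewrite map_mask.
exact: mask_subseq.
Qed.

Lemma avoids_map f s p :
  {mono f : x y / x < y} -> avoids (map f s) p = avoids s p.
Proof.
move=> mono_f; congr (~~ _); apply/containsP/containsP => -[u us iso].
  have [t ts ut] := subseq_map_inv us; exists t => //.
  by move: iso; rewrite ut order_isomorphic_map.
by exists (map f u); rewrite ?order_isomorphic_map // map_subseq.
Qed.

Lemma subseq_rcons_rcons u s (x y : nat) :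
  subseq (rcons u x) (rcons s y) =
    if x == y then subseq u s else subseq (rcons u x) s.
Proof.
rewrite -subseq_rev !rev_rcons /=.
by case: eqP => _; rewrite -?rev_rcons subseq_rev.
Qed.

(** A new occurrence must use the new letter, and a last letter can only play
    the last letter of the pattern. *)
Lemma avoids_rconsP s v p : size p = 3 ->
  avoids (rcons s v) p <->
    avoids s p /\
    forall a b, subseq [:: a; b] s -> ~~ order_isomorphic [:: a; b; v] p.
Proof.
move=> p3; split=> [av | [/(avoidsP _ p3) av H]].
  split=> [|a b ab]; first exact: avoids_subseq (subseq_rcons _ _) av.
  by apply: (avoidsP _ p3 av); rewrite -[_ :: _]/(rcons [:: a; b] v)
       subseq_rcons_rcons eqxx.
apply/(avoidsP _ p3) => a b c; rewrite -[_ :: _]/(rcons [:: a; b] c).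
by rewrite subseq_rcons_rcons; case: eqP => [-> /H | _ /av].
Qed.

Lemma avoids_consP s v p : size p = 3 ->
  avoids (v :: s) p <->
    avoids s p /\
    forall a b, subseq [:: a; b] s -> ~~ order_isomorphic [:: v; a; b] p.
Proof.
move=> p3; split=> [av | [/(avoidsP _ p3) av H]].
  split=> [|a b ab]; first exact: avoids_subseq (subseq_cons _ _) av.
  by apply: (avoidsP _ p3 av); rewrite /= eqxx.
by apply/(avoidsP _ p3) => a b c /=; case: eqP => [-> /H | _ /av].
Qed.

Lemma order_isomorphicE a b c :
  (order_isomorphic [:: a; b; c] p123 = (a < b < c)) *
  (order_isomorphic [:: a; b; c] p132 = (a < c < b)) *
  (order_isomorphic [:: a; b; c] p213 = (b < a < c)) *
  (order_isomorphic [:: a; b; c] p231 = (c < a < b)) *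
  (order_isomorphic [:: a; b; c] p312 = (b < c < a)) *
  (order_isomorphic [:: a; b; c] p321 = (c < b < a)).
Proof.
by do !split; rewrite order_isomorphic3 /= ?eqb_id ?eqbF_neg; lia.
Qed.

(** * Inserting a letter at either end of a permutation *)

Lemma SymP s n :
  reflect [/\ size s = n, uniq s & {in s, forall x, 0 < x <= n}] (s \in Sym n).
Proof.
rewrite in_fset /= mem_permutations; apply: (iffP idP) => [eq_s | [sz_s us H]].
  rewrite (perm_size eq_s) (perm_uniq eq_s) size_iota iota_uniq; split=> // x.
  by rewrite (perm_mem eq_s) mem_iota; lia.
apply: uniq_perm; rewrite ?iota_uniq //.
have sub : {subset s <= iota 1 n} by move=> x /H; rewrite mem_iota; lia.
by have [] := uniq_min_size us sub; rewrite ?size_iota ?sz_s.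
Qed.

Lemma mem_Sym s n x : s \in Sym n -> (x \in s) = (0 < x <= n).
Proof.
by rewrite in_fset /= mem_permutations => /perm_mem ->; rewrite mem_iota; lia.
Qed.

Lemma Sym_pair w n a b : w \in Sym n -> subseq [:: a; b] w ->
  [/\ 0 < a <= n, 0 < b <= n & a != b].
Proof.
case/SymP=> _ uw lw ab; rewrite !lw ?(mem_subseq ab) ?inE ?eqxx ?orbT //.
by have := subseq_uniq ab uw; rewrite /= inE andbT.
Qed.

(** [bump v] adds 1 to the letters that are at least v, which frees the value
    v for the new letter. *)
Definition append v w : word := rcons (map (bump v) w) v.
Definition prepend v w : word := v :: map (bump v) w.

Lemma ltn_bump2 v : {mono bump v : x y / x < y}.
Proof. by move=> x y; rewrite !ltnNge leq_bump2. Qed.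

Lemma bump_inj v : injective (bump v).
Proof. exact: can_inj (bumpK v). Qed.

Lemma perm_append_prepend v w : perm_eq (append v w) (prepend v w).
Proof. by rewrite /append perm_rcons. Qed.

Lemma prepend_Sym v w n :
  w \in Sym n -> 0 < v <= n.+1 -> prepend v w \in Sym n.+1.
Proof.
case/SymP=> sz_w uw lw v_n; apply/SymP; split.
- by rewrite /= size_map sz_w.
- rewrite /= map_inj_uniq ?uw ?andbT; last exact: bump_inj.
  by apply/mapP => -[x _ /eqP]; rewrite (negbTE (neq_bump _ _)).
move=> x; rewrite inE => /predU1P[-> // | /mapP[y /lw y_n ->]].
by rewrite /bump; lia.
Qed.

Lemma perm_Sym s t n : perm_eq s t -> (s \in Sym n) = (t \in Sym n).
Proof. by move/permPl=> st; rewrite !in_fset /= !mem_permutations st. Qed.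

Lemma append_Sym v w n :
  w \in Sym n -> 0 < v <= n.+1 -> append v w \in Sym n.+1.
Proof.
by rewrite (perm_Sym _ (perm_append_prepend v w)) => w_n; apply: prepend_Sym.
Qed.

Lemma Sym_prepend s n : s \in Sym n.+1 ->
  exists v w, [/\ w \in Sym n, 0 < v <= n.+1 & s = prepend v w].
Proof.
case/SymP; case: s => // v t [sz_t] /andP[vt ut] lt.
have v_n : 0 < v <= n.+1 by apply: lt; rewrite inE eqxx.
have tK : map (bump v) (map (unbump v) t) = t.
  rewrite -map_comp -[RHS]map_id; apply/eq_in_map => x xt /=.
  by apply: unbumpK; apply: contraNneq vt => <-.
exists v, (map (unbump v) t); split=> //; last by rewrite /prepend tK.
apply/SymP; split; first by rewrite size_map.
  by rewrite -(map_inj_uniq (@bump_inj v)) tK.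
move=> x /mapP[y yt ->]; have := lt y; rewrite inE yt orbT => /(_ isT).
have : y != v by apply: contraNneq vt => <-.
by rewrite /unbump; lia.
Qed.

Lemma Sym_append s n : s \in Sym n.+1 ->
  exists v w, [/\ w \in Sym n, 0 < v <= n.+1 & s = append v w].
Proof.
case/lastP: s => [/SymP[]|t v] // s_n.
have : v :: t \in Sym n.+1.
  by rewrite -(@perm_Sym (rcons t v)) // perm_rcons.
case/Sym_prepend=> u [w [w_n u_n [vu tw]]]; exists u, w; split=> //.
by rewrite /append -tw vu.
Qed.

Lemma append_inj v v' w w' : append v w = append v' w' -> w = w'.
Proof. by case/rcons_inj=> /[swap] -> /(inj_map (@bump_inj _)). Qed.

Lemma prepend_inj v v' w w' : prepend v w = prepend v' w' -> w = w'.
Proof. by case=> -> /(inj_map (@bump_inj _)). Qed.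

Lemma maj_append v w : maj (append v w) = maj w + (v <= last 0 w) * size w.
Proof.
rewrite maj_rcons (maj_map _ (@ltn_bump2 v)) size_map; congr (_ + _).
case: w => //= [|x w]; rewrite ?muln0 // last_map; congr (_ * _).
by rewrite /bump; lia.
Qed.

Lemma inv_append v w : inv (append v w) = inv w + count (leq v) w.
Proof.
rewrite inv_rcons (inv_map _ (@ltn_bump2 v)) count_map; congr (_ + _).
by apply: eq_count => x /=; rewrite /bump; lia.
Qed.

Lemma inv_prepend v w : inv (prepend v w) = inv w + count (ltn^~ v) w.
Proof.
rewrite inv_cons (inv_map _ (@ltn_bump2 v)) count_map; congr (_ + _).
by apply: eq_count => x /=; rewrite /bump; lia.
Qed.

(** * Avoidance after an insertion *)

Lemma avoids_appendP v w p : size p = 3 ->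
  avoids (append v w) p <-> avoids w p /\
    forall a b, subseq [:: a; b] w ->
      ~~ order_isomorphic [:: bump v a; bump v b; v] p.
Proof.
move=> p3; rewrite avoids_rconsP // (avoids_map _ _ (@ltn_bump2 v)).
split=> -[av H]; split=> // a b.
  by move/(map_subseq (bump v)) => /H.
case/subseq_map_inv => -[|x [|y []]] // xy [-> ->]; exact: H.
Qed.

Lemma avoids_prependP v w p : size p = 3 ->
  avoids (prepend v w) p <-> avoids w p /\
    forall a b, subseq [:: a; b] w ->
      ~~ order_isomorphic [:: v; bump v a; bump v b] p.
Proof.
move=> p3; rewrite avoids_consP // (avoids_map _ _ (@ltn_bump2 v)).
split=> -[av H]; split=> // a b.
  by move/(map_subseq (bump v)) => /H.
case/subseq_map_inv => -[|x [|y []]] // xy [-> ->]; exact: H.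
Qed.

Lemma avoids_append_neutral v w p : size p = 3 ->
    (forall a b, avoids w p -> subseq [:: a; b] w ->
      ~~ order_isomorphic [:: bump v a; bump v b; v] p) ->
  avoids (append v w) p = avoids w p.
Proof.
move=> p3 H; apply/idP/idP => [/(avoids_appendP _ _ p3)[] // | av].
by apply/avoids_appendP => //; split=> // a b; apply: H.
Qed.

Lemma avoids_append_sorted (r : rel nat) v w p : transitive r -> size p = 3 ->
    (forall a b, subseq [:: a; b] w ->
      ~~ order_isomorphic [:: bump v a; bump v b; v] p = r a b) ->
  avoids (append v w) p = avoids w p && sorted r w.
Proof.
move=> tr p3 H; apply/idP/andP.
  case/(avoids_appendP _ _ p3)=> av K; split=> //.
  by apply/(sorted_subseqP tr) => a b ab; rewrite -H ?K.
case=> av /(sorted_subseqP tr) K; apply/avoids_appendP => //.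
by split=> // a b ab; rewrite H ?K.
Qed.

Lemma avoids_prepend_neutral v w p : size p = 3 ->
    (forall a b, subseq [:: a; b] w ->
      ~~ order_isomorphic [:: v; bump v a; bump v b] p) ->
  avoids (prepend v w) p = avoids w p.
Proof.
move=> p3 H; apply/idP/idP => [/(avoids_prependP _ _ p3)[] // | av].
by apply/avoids_prependP => //; split=> // a b; apply: H.
Qed.

Lemma avoids_prepend_sorted (r : rel nat) v w p : transitive r -> size p = 3 ->
    (forall a b, subseq [:: a; b] w ->
      ~~ order_isomorphic [:: v; bump v a; bump v b] p = r a b) ->
  avoids (prepend v w) p = avoids w p && sorted r w.
Proof.
move=> tr p3 H; apply/idP/andP.
  case/(avoids_prependP _ _ p3)=> av K; split=> //.
  by apply/(sorted_subseqP tr) => a b ab; rewrite -H ?K.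
case=> av /(sorted_subseqP tr) K; apply/avoids_prependP => //.
by split=> // a b ab; rewrite H ?K.
Qed.

(** For a new letter that is the maximum or the minimum, a pattern either
    never uses it, or uses it with two old letters in a prescribed order; the
    remaining condition is then monotonicity of the old word. *)
Ltac extreme_letter w_n :=
  do !split; first
    [ apply: avoids_append_neutral => // a b _
    | apply: avoids_prepend_neutral => // a b
    | apply: avoids_append_sorted => [|//|a b];
        first by [exact: ltn_trans|exact: gtn_trans]
    | apply: avoids_prepend_sorted => [|//|a b];
        first by [exact: ltn_trans|exact: gtn_trans] ];
  move=> /(Sym_pair w_n)[]; rewrite order_isomorphicE /bump /=; lia.

Lemma avoids_append_top w n : w \in Sym n ->
  (avoids (append n.+1 w) p123 = avoids w p123 && decreasing w) *
  (avoids (append n.+1 w) p132 = avoids w p132) *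
  (avoids (append n.+1 w) p213 = avoids w p213 && increasing w) *
  (avoids (append n.+1 w) p231 = avoids w p231) *
  (avoids (append n.+1 w) p312 = avoids w p312) *
  (avoids (append n.+1 w) p321 = avoids w p321).
Proof. by move=> w_n; extreme_letter w_n. Qed.

Lemma avoids_append_bottom w n : w \in Sym n ->
  (avoids (append 1 w) p123 = avoids w p123) *
  (avoids (append 1 w) p132 = avoids w p132) *
  (avoids (append 1 w) p213 = avoids w p213) *
  (avoids (append 1 w) p231 = avoids w p231 && decreasing w) *
  (avoids (append 1 w) p312 = avoids w p312) *
  (avoids (append 1 w) p321 = avoids w p321 && increasing w).
Proof. by move=> w_n; extreme_letter w_n. Qed.

Lemma avoids_prepend_top w n : w \in Sym n ->
  (avoids (prepend n.+1 w) p123 = avoids w p123) *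
  (avoids (prepend n.+1 w) p132 = avoids w p132) *
  (avoids (prepend n.+1 w) p213 = avoids w p213) *
  (avoids (prepend n.+1 w) p231 = avoids w p231) *
  (avoids (prepend n.+1 w) p312 = avoids w p312 && decreasing w) *
  (avoids (prepend n.+1 w) p321 = avoids w p321 && increasing w).
Proof. by move=> w_n; extreme_letter w_n. Qed.

Lemma avoids_prepend_bottom w n : w \in Sym n ->
  (avoids (prepend 1 w) p123 = avoids w p123 && decreasing w) *
  (avoids (prepend 1 w) p132 = avoids w p132 && increasing w) *
  (avoids (prepend 1 w) p213 = avoids w p213) *
  (avoids (prepend 1 w) p231 = avoids w p231) *
  (avoids (prepend 1 w) p312 = avoids w p312) *
  (avoids (prepend 1 w) p321 = avoids w p321).
Proof. by move=> w_n; extreme_letter w_n. Qed.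

(** An occurrence of a pattern that ends with the appended letter either has
    the old last letter k in the middle, or does not use k; in the second case k can
    take the place of the new letter when the new letter is next to k in
    value. *)
Lemma Sym_pair_last w n a b : w \in Sym n -> subseq [:: a; b] w ->
  b = last 0 w \/
  [/\ a != last 0 w, b != last 0 w & subseq [:: a; b; last 0 w] w].
Proof.
case/SymP=> _ uw _; case/lastP: w uw => // w x uw ab; rewrite last_rcons.
have := ab; rewrite -[_ :: _]/(rcons [:: a] b) subseq_rcons_rcons.
case: eqP => [-> | _ /= ab_w]; first by left.
have abx : subseq [:: a; b; x] (rcons w x).
  by rewrite -[_ :: _]/(rcons [:: a; b] x) subseq_rcons_rcons eqxx.
right; split=> //; have := subseq_uniq abx uw;
  by rewrite /= !inE negb_or andbT => /andP[/andP[]].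
Qed.

Ltac next_to_last_letter w_n :=
  do !split; (apply: avoids_append_neutral => // a b av ab;
  have [? ? ?] := Sym_pair w_n ab;
  have [b_last | [a_k b_k abk]] := Sym_pair_last w_n ab;
  [ | have := avoids_not_iso av abk ];
  rewrite !order_isomorphicE /bump; lia).

Lemma avoids_append_above_last w n : w \in Sym n ->
  (avoids (append (last 0 w).+1 w) p132 = avoids w p132) *
  (avoids (append (last 0 w).+1 w) p213 = avoids w p213) *
  (avoids (append (last 0 w).+1 w) p231 = avoids w p231) *
  (avoids (append (last 0 w).+1 w) p321 = avoids w p321).
Proof. by move=> w_n; next_to_last_letter w_n. Qed.

Lemma avoids_append_last w n : w \in Sym n ->
  (avoids (append (last 0 w) w) p123 = avoids w p123) *
  (avoids (append (last 0 w) w) p213 = avoids w p213) *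
  (avoids (append (last 0 w) w) p231 = avoids w p231) *
  (avoids (append (last 0 w) w) p312 = avoids w p312).
Proof. by move=> w_n; next_to_last_letter w_n. Qed.

Lemma decreasing_avoids w p :
  decreasing w -> p \in [:: p123; p132; p213; p231; p312] -> avoids w p.
Proof.
move=> /decreasingP dec p_in; have p3 : size p = 3.
  by move: p_in; rewrite !inE; do !case/predU1P=> [-> //|]; move/eqP->.
apply/(avoidsP _ p3) => a b c abc.
have /dec /= ab : subseq [:: a; b] w.
  by apply: subseq_trans abc; rewrite /= !eqxx.
have /dec /= bc : subseq [:: b; c] w by apply: cons_subseq abc.
move: p_in; rewrite !inE.
by do ![case/predU1P=> [-> |]]; last (move/eqP->);
  rewrite order_isomorphicE; lia.
Qed.

Lemma increasing_avoids w p :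
  increasing w -> p \in [:: p132; p213; p231; p312; p321] -> avoids w p.
Proof.
move=> /increasingP inc p_in; have p3 : size p = 3.
  by move: p_in; rewrite !inE; do !case/predU1P=> [-> //|]; move/eqP->.
apply/(avoidsP _ p3) => a b c abc.
have /inc /= ab : subseq [:: a; b] w.
  by apply: subseq_trans abc; rewrite /= !eqxx.
have /inc /= bc : subseq [:: b; c] w by apply: cons_subseq abc.
move: p_in; rewrite !inE.
by do ![case/predU1P=> [-> |]]; last (move/eqP->);
  rewrite order_isomorphicE; lia.
Qed.

(** Let k be the last letter of w, and suppose that a < b occur in w in this
    order.  If a < k, which includes the case b = k, then a, k and the new
    letter k+1 form 123; if a > k, then a, b and k form 231. *)
Lemma avoids_append_above_last_p123 w n : w \in Sym n -> avoids w p231 ->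
  avoids (append (last 0 w).+1 w) p123 = avoids w p123 && decreasing w.
Proof.
move=> w_n av231; apply/idP/idP.
  case/avoids_appendP=> // av K; rewrite av /=; apply/decreasingP => a b ab.
  have [? ? ?] := Sym_pair w_n ab.
  have [b_k | [a_k b_k abk]] := Sym_pair_last w_n ab.
    by have := K _ _ ab; rewrite order_isomorphicE /bump /=; lia.
  have := avoids_not_iso av231 abk.
  have ak : subseq [:: a; last 0 w] w.
    by apply: subseq_trans abk; rewrite /= eqxx; case: eqP; rewrite ?eqxx.
  by have := K _ _ ak; rewrite !order_isomorphicE /bump /=; lia.
case/andP=> av /decreasingP dec.
apply/avoids_appendP => //; split=> // a b /dec.
by rewrite order_isomorphicE /bump /=; lia.
Qed.

(** The mirror image of the previous argument: for a > b in this order, either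
    a > k, and then a, k and the new letter form 321, or a < k, and then
    a, b and k form 213. *)
Lemma avoids_append_last_p321 w n : w \in Sym n -> avoids w p213 ->
  avoids (append (last 0 w) w) p321 = avoids w p321 && increasing w.
Proof.
move=> w_n av213; apply/idP/idP.
  case/avoids_appendP=> // av K; rewrite av /=; apply/increasingP => a b ab.
  have [? ? ?] := Sym_pair w_n ab.
  have [b_k | [a_k b_k abk]] := Sym_pair_last w_n ab.
    by have := K _ _ ab; rewrite order_isomorphicE /bump /=; lia.
  have := avoids_not_iso av213 abk.
  have ak : subseq [:: a; last 0 w] w.
    by apply: subseq_trans abk; rewrite /= eqxx; case: eqP; rewrite ?eqxx.
  by have := K _ _ ak; rewrite !order_isomorphicE /bump /=; lia.
case/andP=> av /increasingP inc.
apply/avoids_appendP => //; split=> // a b /inc.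
by rewrite order_isomorphicE /bump /=; lia.
Qed.

(** * The recurrence for the generating functions *)

(** An increase of 0 under f0 and of n under f1 is what gives the factor
    1 + q^n of the recurrence. *)
Record branching (st : word -> nat) n (f0 f1 : word -> word) : Prop :=
  Branching {
  branch0_Sym : {in Sym n, forall w, f0 w \in Sym n.+1};
  branch1_Sym : {in Sym n, forall w, f1 w \in Sym n.+1};
  branch0_stat : {in Sym n, forall w, st (f0 w) = st w};
  branch1_stat : {in Sym n, forall w, st (f1 w) = st w + n};
  branch0_inj : {in Sym n &, injective f0};
  branch1_inj : {in Sym n &, injective f1};
  branch_disjoint : {in Sym n &, forall w w', f0 w <> f1 w'} }.

Definition avoids_all (Pi : {fset word}) s := all (avoids s) Pi.

(** The restrictions c0 and c1 carry the effect of a third pattern in Pi; both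
    are trivial when Pi has two patterns. *)
Record grows st (Pi : {fset word}) (c0 c1 : pred word) n f0 f1 : Prop := Grows {
  grows_branching : branching st n f0 f1;
  grows0 : {in Sym n, forall w, avoids_all Pi (f0 w) = avoids_all Pi w && c0 w};
  grows1 : {in Sym n, forall w, avoids_all Pi (f1 w) = avoids_all Pi w && c1 w};
  grows_cover : {in Sym n.+1, forall s, avoids_all Pi s ->
    exists2 w, w \in Sym n & s = f0 w \/ s = f1 w} }.

Definition gen_fun (st : word -> nat) (P : pred word) n : {poly int} :=
  (\sum_(s <- Sym n | P s) 'X^(st s))%R.

Lemma gen_fun_grows st Pi c0 c1 n f0 f1 : grows st Pi c0 c1 n f0 f1 ->
  (gen_fun st (avoids_all Pi) n.+1 =
     gen_fun st (fun w => avoids_all Pi w && c0 w) n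
     + 'X^n * gen_fun st (fun w => avoids_all Pi w && c1 w) n)%R.
Proof.
case=> -[S0 S1 st0 st1 inj0 inj1 disj] P0 P1 cov.
pose W c := [seq w <- Sym n | avoids_all Pi w && c w].
have WS c : {subset W c <= Sym n} by move=> w; rewrite mem_filter => /andP[].
have uW c : uniq (W c) by rewrite filter_uniq ?fset_uniq.
rewrite /gen_fun -[LHS]big_filter -[X in (X + _)%R]big_filter.
rewrite -[X in (_ * X)%R]big_filter.
rewrite (perm_big (map f0 (W c0) ++ map f1 (W c1))) /=.
  rewrite big_cat !big_map big_distrr /=; congr (_ + _)%R.
    by apply: eq_big_seq => w /WS /st0 ->.
  by apply: eq_big_seq => w /WS /st1 ->; rewrite addnC GRing.exprD.
apply: uniq_perm; first by rewrite filter_uniq ?fset_uniq.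
  rewrite cat_uniq !map_inj_in_uniq ?uW ?andbT /=; last first.
  - by move=> x y /WS Sx /WS Sy; apply: inj0.
  - by move=> x y /WS Sx /WS Sy; apply: inj1.
  apply/hasPn => _ /mapP[x /WS Sx ->]; apply/mapP => -[y /WS Sy].
  by move/esym; apply: disj.
move=> s; rewrite mem_filter mem_cat; apply/andP/orP.
  case=> Ps /[dup] Ss /cov -/(_ Ps)[w Sw [] sE]; [left|right];
    by rewrite sE map_f // mem_filter Sw andbT -?P0 -?P1 -?sE.
by case=> /mapP[w]; rewrite mem_filter => /andP[Pw Sw] ->;
  rewrite ?P0 ?P1 ?S0 ?S1.
Qed.

(** A restriction c contributes the same term to the recurrence for maj and to
    that for inv if it is vacuous, by induction, or if its words all avoid Pi
    and have equal statistics, because then the term depends on c only. *)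
Definition tame (Pi : {fset word}) (c : pred word) :=
  c =1 predT \/ forall s, c s -> avoids_all Pi s /\ maj s = inv s.

Definition family st (Pi : {fset word}) (c0 c1 : pred word) :=
  [/\ all (fun p => 1 < size p) Pi,
      forall n, 0 < n -> exists f0 f1, grows st Pi c0 c1 n f0 f1,
      tame Pi c0 & tame Pi c1].

Lemma tame_gen_fun Pi Pi' c n : tame Pi c -> tame Pi' c ->
    gen_fun maj (avoids_all Pi) n = gen_fun inv (avoids_all Pi') n ->
  gen_fun maj (fun w => avoids_all Pi w && c w) n =
  gen_fun inv (fun w => avoids_all Pi' w && c w) n.
Proof.
case=> [cT | tm]; last case=> [cT | tm' _].
- move=> _ eq_gen_fun; rewrite /gen_fun (eq_bigl (avoids_all Pi)); last first.
    by move=> s; rewrite cT andbT.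
  by rewrite [RHS](eq_bigl (avoids_all Pi')) => [|s]; rewrite ?cT ?andbT.
- move=> eq_gen_fun; rewrite /gen_fun (eq_bigl (avoids_all Pi)); last first.
    by move=> s; rewrite cT andbT.
  by rewrite [RHS](eq_bigl (avoids_all Pi')) => [|s]; rewrite ?cT ?andbT.
rewrite /gen_fun; apply: eq_big => s.
  by case c_s: (c s); rewrite ?andbF // (tm _ c_s).1 (tm' _ c_s).1.
by case/andP=> _ /tm[_ ->].
Qed.

Lemma avoids_all_short (Pi : {fset word}) s :
  all (fun p => 1 < size p) Pi -> size s <= 1 -> avoids_all Pi s.
Proof.
move=> /allP Pi2 s1; apply/allP => p /Pi2 /= p2.
apply/containsP => -[u /size_subseq us /andP[/eqP sz_u _]].
by have := leq_trans p2 (leq_trans _ s1); rewrite -sz_u => /(_ us).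
Qed.

(** The insertions need a nonempty word: for n = 0 both insertions give the
    word 1.  For n <= 1 no pattern can occur and both statistics are 0. *)
Lemma family_mahonian Pi Pi' c0 c1 :
    family maj Pi c0 c1 -> family inv Pi' c0 c1 ->
  forall n, mahonian_pair (Av n Pi) (Av n Pi').
Proof.
move=> [Pi2 gr tm0 tm1] [Pi'2 gr' tm0' tm1'] n; rewrite /mahonian_pair.
rewrite -!big_fset_condE -/(gen_fun maj (avoids_all Pi) n).
rewrite -/(gen_fun inv (avoids_all Pi') n).
have small m : m <= 1 ->
    gen_fun maj (avoids_all Pi) m = gen_fun inv (avoids_all Pi') m.
  move=> m1; rewrite /gen_fun big_seq_cond [RHS]big_seq_cond.
  have short s : s \in Sym m -> size s <= 1 by case/SymP=> ->.
  apply: eq_big => s; last first.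
    case/andP=> /short s1 _; rewrite increasing_maj_inv //.
    by case: s s1 => [|x []].
  by case: (boolP (s \in Sym m)) => //= /short s1; rewrite !avoids_all_short.
elim: n => [|[|n] IHn]; [exact: small | exact: small |].
have [f0 [f1 /gen_fun_grows ->]] := gr n.+1 isT.
have [g0 [g1 /gen_fun_grows ->]] := gr' n.+1 isT.
by rewrite !(@tame_gen_fun _ Pi').
Qed.

Lemma last_Sym w n : 0 < n -> w \in Sym n -> 0 < last 0 w <= n.
Proof.
move=> n_gt0 w_n; rewrite -(mem_Sym _ w_n).
case: w w_n => [/SymP[sz_w] | x w _]; last by rewrite /= mem_last.
by move: n_gt0; rewrite -sz_w.
Qed.

Lemma head_Sym w n : 0 < n -> w \in Sym n -> 0 < head 0 w <= n.
Proof.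
move=> n_gt0 w_n; rewrite -(mem_Sym _ w_n).
case: w w_n => [/SymP[sz_w] | x w _]; last by rewrite /= mem_head.
by move: n_gt0; rewrite -sz_w.
Qed.

(** * Insertions for maj and for inv *)

Lemma maj_branching n (hi lo : word -> nat) : 0 < n ->
    {in Sym n, forall w, (0 < lo w <= last 0 w) && (last 0 w < hi w <= n.+1)} ->
  branching maj n (fun w => append (hi w) w) (fun w => append (lo w) w).
Proof.
move=> n_gt0 bounds.
have last_n w : w \in Sym n -> last 0 w <= n by case/(last_Sym n_gt0)/andP.
split.
- by move=> w w_n; apply: append_Sym => //; have := bounds w w_n; lia.
- move=> w w_n; apply: append_Sym => //.
  by have := bounds w w_n; have := last_n w w_n; lia.
- move=> w w_n; rewrite maj_append leqNgt.
  have /andP[_ /andP[-> _]] := bounds w w_n.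
  by rewrite mul0n addn0.
- move=> w w_n; rewrite maj_append; have /andP[/andP[_ ->] _] := bounds w w_n.
  by rewrite mul1n; case/SymP: w_n => ->.
- by move=> w w' _ _ /append_inj.
- by move=> w w' _ _ /append_inj.
move=> w w' w_n w'_n E; have ww' := append_inj E; move: E.
rewrite -ww' => /rcons_inj[_ E].
by have := bounds w w_n; rewrite E; have := bounds w' w'_n; rewrite ww'; lia.
Qed.

Lemma inv_append_top w n : w \in Sym n -> inv (append n.+1 w) = inv w.
Proof.
case/SymP=> _ _ lw; rewrite inv_append (@eq_in_count _ _ pred0).
  by rewrite count_pred0 addn0.
by move=> x /lw /=; lia.
Qed.

Lemma inv_prepend_bottom w n : w \in Sym n -> inv (prepend 1 w) = inv w.
Proof.
case/SymP=> _ _ lw; rewrite inv_prepend (@eq_in_count _ _ pred0).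
  by rewrite count_pred0 addn0.
by move=> x /lw /=; lia.
Qed.

Lemma inv_append_bottom w n : w \in Sym n -> inv (append 1 w) = inv w + n.
Proof.
case/SymP=> sz_w _ lw; rewrite inv_append (@eq_in_count _ _ predT).
  by rewrite count_predT sz_w.
by move=> x /lw /=; lia.
Qed.

Lemma inv_prepend_top w n : w \in Sym n -> inv (prepend n.+1 w) = inv w + n.
Proof.
case/SymP=> sz_w _ lw; rewrite inv_prepend (@eq_in_count _ _ predT).
  by rewrite count_predT sz_w.
by move=> x /lw /=; lia.
Qed.

(** Comparing the two ends tells which insertion was made last: f0 for inv
    always makes the word rise, f1 always makes it fall. *)
Definition rises s := head 0 s < last 0 s.

Lemma rises_append v w n : 0 < n -> w \in Sym n ->
  rises (append v w) = (bump v (head 0 w) < v).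
Proof.
move=> n_gt0 /SymP[]; case: w n_gt0 => [|x w] sz_w;
  by rewrite /rises /= ?last_rcons; lia.
Qed.

Lemma rises_prepend v w n : 0 < n -> w \in Sym n ->
  rises (prepend v w) = (v < bump v (last 0 w)).
Proof.
move=> n_gt0 /SymP[]; case: w n_gt0 => [|x w] sz_w;
  by rewrite /rises /= ?last_map //; lia.
Qed.

Lemma inv_branching n f0 f1 : 0 < n ->
    f0 = append n.+1 \/ f0 = prepend 1 -> f1 = append 1 \/ f1 = prepend n.+1 ->
  branching inv n f0 f1.
Proof.
move=> n_gt0 f0E f1E; split.
- by move=> w w_n; case: f0E => ->;
    [apply: append_Sym | apply: prepend_Sym]; rewrite ?ltnSn.
- by move=> w w_n; case: f1E => ->;
    [apply: append_Sym | apply: prepend_Sym]; rewrite ?ltnSn.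
- by move=> w w_n; case: f0E => ->;
    rewrite ?(inv_append_top w_n) ?(inv_prepend_bottom w_n).
- by move=> w w_n; case: f1E => ->;
    rewrite ?(inv_append_bottom w_n) ?(inv_prepend_top w_n).
- by move=> w w' _ _; case: f0E => -> => [/append_inj | /prepend_inj].
- by move=> w w' _ _; case: f1E => -> => [/append_inj | /prepend_inj].
move=> w w' w_n w'_n /(congr1 rises).
have last_w := last_Sym n_gt0 w_n; have last_w' := last_Sym n_gt0 w'_n.
have head_w := head_Sym n_gt0 w_n; have head_w' := head_Sym n_gt0 w'_n.
suff [-> ->] : rises (f0 w) /\ rises (f1 w') = false by [].
split; [case: f0E => -> | case: f1E => ->];
  by rewrite ?(rises_append _ n_gt0 w_n) ?(rises_prepend _ n_gt0 w_n)
       ?(rises_append _ n_gt0 w'_n) ?(rises_prepend _ n_gt0 w'_n) /bump; lia.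
Qed.

(** * Two patterns leave only two insertions *)

Lemma append_pair v w n p m : w \in Sym n -> avoids (append v w) p ->
    size p = 3 -> 0 < m <= n -> m != last 0 w ->
  ~~ order_isomorphic [:: bump v m; bump v (last 0 w); v] p.
Proof.
move=> w_n /avoids_appendP/[swap] p3 /(_ p3)[_ H] m_n m_last; apply: H.
rewrite -(mem_Sym _ w_n) in m_n.
case/lastP: w w_n m_n m_last => // w x _; rewrite last_rcons mem_rcons inE.
move=> m_w /negbTE m_x; rewrite m_x /= in m_w.
by rewrite -[_ :: _]/(rcons [:: m] x) subseq_rcons_rcons eqxx sub1seq.
Qed.

(** In this lemma and the three that follow, let k be the last letter of w.
    For any other v there is a letter m of w that forms the forbidden pattern
    together with k and the new letter: m is k+1, v, v and 1 respectively. *)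
Lemma append_ascent_p213 n v w : w \in Sym n -> 0 < v <= n.+1 ->
  avoids (append v w) p213 -> last 0 w < v -> v = (last 0 w).+1.
Proof.
move=> w_n v_n av lt_v; apply/eqP; apply: contraT => v_last.
have := append_pair (m := (last 0 w).+1) w_n av erefl.
by rewrite order_isomorphicE /bump; lia.
Qed.

Lemma append_ascent_p312 n v w : w \in Sym n -> 0 < v <= n.+1 ->
  avoids (append v w) p312 -> last 0 w < v -> v = n.+1.
Proof.
move=> w_n v_n av lt_v; apply/eqP; apply: contraT => v_last.
have := append_pair (m := v) w_n av erefl.
by rewrite order_isomorphicE /bump; lia.
Qed.

Lemma append_descent_p231 n v w : 0 < n -> w \in Sym n -> 0 < v <= n.+1 ->
  avoids (append v w) p231 -> v <= last 0 w -> v = last 0 w.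
Proof.
move=> n_gt0 w_n v_n av le_v; apply/eqP; apply: contraT => v_last.
have last_n := last_Sym n_gt0 w_n.
have := append_pair (m := v) w_n av erefl.
by rewrite order_isomorphicE /bump; lia.
Qed.

Lemma append_descent_p132 n v w : 0 < n -> w \in Sym n -> 0 < v <= n.+1 ->
  avoids (append v w) p132 -> v <= last 0 w -> v = 1.
Proof.
move=> n_gt0 w_n v_n av le_v; apply/eqP; apply: contraT => v_last.
have last_n := last_Sym n_gt0 w_n.
have := append_pair (m := 1) w_n av erefl.
by rewrite order_isomorphicE /bump; lia.
Qed.

(** Otherwise the first letter together with 1 and n+1, in whichever order
    they come, forms 213 or 231. *)
Lemma first_extreme v w n : w \in Sym n -> 0 < v <= n.+1 ->
    avoids (prepend v w) p213 -> avoids (prepend v w) p231 ->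
  v = 1 \/ v = n.+1.
Proof.
move=> w_n v_n /avoids_prependP -/(_ erefl)[_ H213].
move=> /avoids_prependP -/(_ erefl)[_ H231].
case: (v =P 1) => [|v1]; first by left.
case: (v =P n.+1) => [|vn]; first by right.
have in1 : 1 \in w by rewrite (mem_Sym _ w_n); lia.
have inn : n \in w by rewrite (mem_Sym _ w_n); lia.
have [|] : subseq [:: 1; n] w \/ subseq [:: n; 1] w.
  case/splitPr: in1 inn => w1 w2; rewrite mem_cat inE.
  case/or3P=> [n_w1 | /eqP | n_w2].
  - by right; apply: (@cat_subseq _ [:: n] [:: 1]); rewrite sub1seq ?mem_head.
  - lia.
  by left; apply: (@cat_subseq _ [::] [:: 1; n]); rewrite ?sub0seq //= sub1seq.
- by move/H213; rewrite order_isomorphicE /bump; lia.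
by move/H231; rewrite order_isomorphicE /bump; lia.
Qed.

Lemma subseq_ends s m : m \in s -> m != head 0 s -> m != last 0 s ->
  subseq [:: head 0 s; m; last 0 s] s.
Proof.
case: s => [|u s]; rewrite // inE => /predU1P[-> /eqP // |].
case/lastP: s => // s v; rewrite /= last_rcons eqxx mem_rcons inE.
move=> /predU1P[-> _ /eqP // | m_s _ _].
by rewrite -[_ :: _]/(rcons [:: m] v) subseq_rcons_rcons eqxx sub1seq.
Qed.

Lemma head_neq_last s n : 0 < n -> s \in Sym n.+1 -> head 0 s != last 0 s.
Proof.
move=> n_gt0 /SymP[]; case: s => // u s; case/lastP: s => [[] | s v _] /=.
  by lia.
by rewrite last_rcons mem_rcons inE negb_or => /andP[/andP[]].
Qed.

(** Otherwise the first letter, n+1 and the last letter form 132 or 231. *)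
Lemma maximum_at_end s n : 0 < n -> s \in Sym n.+1 ->
    avoids s p132 -> avoids s p231 ->
  head 0 s = n.+1 \/ last 0 s = n.+1.
Proof.
move=> n_gt0 s_n av132 av231; have neq := head_neq_last n_gt0 s_n.
have [head_s last_s] := (@head_Sym _ n.+1 isT s_n, @last_Sym _ n.+1 isT s_n).
case: (head 0 s =P n.+1) => [|/eqP neq_h]; first by left.
case: (last 0 s =P n.+1) => [|/eqP neq_l]; first by right.
have := @subseq_ends s n.+1; rewrite (mem_Sym _ s_n) ltnSn !(eq_sym n.+1).
move=> /(_ isT neq_h neq_l) sub.
have := avoids_not_iso av132 sub; have := avoids_not_iso av231 sub.
by rewrite !order_isomorphicE; lia.
Qed.

(** Otherwise the first letter, 1 and the last letter form 213 or 312. *)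
Lemma minimum_at_end s n : 0 < n -> s \in Sym n.+1 ->
    avoids s p213 -> avoids s p312 ->
  head 0 s = 1 \/ last 0 s = 1.
Proof.
move=> n_gt0 s_n av213 av312; have neq := head_neq_last n_gt0 s_n.
have [head_s last_s] := (@head_Sym _ n.+1 isT s_n, @last_Sym _ n.+1 isT s_n).
case: (head 0 s =P 1) => [|/eqP neq_h]; first by left.
case: (last 0 s =P 1) => [|/eqP neq_l]; first by right.
have := @subseq_ends s 1; rewrite (mem_Sym _ s_n) !(eq_sym 1).
move=> /(_ isT neq_h neq_l) sub.
have := avoids_not_iso av213 sub; have := avoids_not_iso av312 sub.
by rewrite !order_isomorphicE; lia.
Qed.

Lemma Sym_append_last s n : s \in Sym n.+1 ->
  exists2 w, w \in Sym n & s = append (last 0 s) w.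
Proof.
case/Sym_append=> v [w [w_n _ ->]]; exists w => //.
by rewrite {2}/append last_rcons.
Qed.

Lemma Sym_prepend_head s n : s \in Sym n.+1 ->
  exists2 w, w \in Sym n & s = prepend (head 0 s) w.
Proof. by case/Sym_prepend=> v [w [w_n _ ->]]; exists w. Qed.

Lemma avoids_mem Pi s p : avoids_all Pi s -> p \in Pi -> avoids s p.
Proof. by move/allP; apply. Qed.

Definition last_letter_rule (Pi : {fset word}) n (hi lo : word -> nat) : Prop :=
  ((p213 \in Pi /\ {in Sym n, forall w, hi w = (last 0 w).+1}) \/
   (p312 \in Pi /\ {in Sym n, forall w, hi w = n.+1})) /\
  ((p231 \in Pi /\ {in Sym n, forall w, lo w = last 0 w}) \/
   (p132 \in Pi /\ {in Sym n, forall w, lo w = 1})).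

Lemma last_letter_cover Pi n hi lo : 0 < n -> last_letter_rule Pi n hi lo ->
  {in Sym n.+1, forall s, avoids_all Pi s ->
    exists2 w, w \in Sym n & s = append (hi w) w \/ s = append (lo w) w}.
Proof.
move=> n_gt0 [hiE loE] s /Sym_append[v [w [w_n v_n ->]]] Pi_s; exists w => //.
have av p : p \in Pi -> avoids (append v w) p by apply: avoids_mem.
have [v_last | last_v] := leqP v (last 0 w); [right | left]; congr append.
  case: loE => -[/av av_p ->] //.
    exact: append_descent_p231 n_gt0 w_n v_n av_p v_last.
  exact: append_descent_p132 n_gt0 w_n v_n av_p v_last.
case: hiE => -[/av av_p ->] //.
  exact: append_ascent_p213 w_n v_n av_p last_v.
exact: append_ascent_p312 w_n v_n av_p last_v.
Qed.

Lemma grows_maj Pi c0 c1 n hi lo : 0 < n -> last_letter_rule Pi n hi lo ->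
    {in Sym n, forall w,
       avoids_all Pi (append (hi w) w) = avoids_all Pi w && c0 w} ->
    {in Sym n, forall w,
       avoids_all Pi (append (lo w) w) = avoids_all Pi w && c1 w} ->
  grows maj Pi c0 c1 n (fun w => append (hi w) w) (fun w => append (lo w) w).
Proof.
move=> n_gt0 rule P0 P1; split=> //; last exact: last_letter_cover.
apply: maj_branching => // w w_n; have := last_Sym n_gt0 w_n.
by case: rule => -[] [_ ->] // [] [_ ->] //; lia.
Qed.

(** Avoiding 132 and 312 makes the last letter extreme, and avoiding 213 and
    231 the first one; avoiding 132 and 231 puts the maximum at an end, and
    avoiding 213 and 312 the minimum. *)
Lemma grows_inv Pi c0 c1 n f0 f1 : 0 < n ->
    (p132 \in Pi /\ f0 = append n.+1) \/ (p213 \in Pi /\ f0 = prepend 1) ->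
    (p312 \in Pi /\ f1 = append 1) \/ (p231 \in Pi /\ f1 = prepend n.+1) ->
    {in Sym n, forall w, avoids_all Pi (f0 w) = avoids_all Pi w && c0 w} ->
    {in Sym n, forall w, avoids_all Pi (f1 w) = avoids_all Pi w && c1 w} ->
  grows inv Pi c0 c1 n f0 f1.
Proof.
move=> n_gt0 f0E f1E P0 P1; split=> //.
  by apply: inv_branching => //; [case: f0E | case: f1E] => -[_ ->];
    [left | right | left | right].
move=> s s_n Pi_s.
have av p : p \in Pi -> avoids s p by apply: avoids_mem.
have [w w_n sE] := Sym_append_last s_n.
have [w' w'_n sE'] := Sym_prepend_head s_n.
case: f0E f1E => -[p0 ->] [] [p1 ->].
- apply: (@last_letter_cover Pi n (fun=> n.+1) (fun=> 1)) => //.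
  by split; right.
- have [head_s | last_s] := maximum_at_end n_gt0 s_n (av _ p0) (av _ p1).
    by exists w' => //; right; rewrite {1}sE' head_s.
  by exists w => //; left; rewrite {1}sE last_s.
- have [head_s | last_s] := minimum_at_end n_gt0 s_n (av _ p0) (av _ p1).
    by exists w' => //; left; rewrite {1}sE' head_s.
  by exists w => //; right; rewrite {1}sE last_s.
have [|||head_s|head_s] := @first_extreme (head 0 s) w' n w'_n.
- by have := @head_Sym _ n.+1 isT s_n.
- by rewrite -sE'; apply: av.
- by rewrite -sE'; apply: av.
- by exists w' => //; left; rewrite {1}sE' head_s.
by exists w' => //; right; rewrite {1}sE' head_s.
Qed.

(** * The classes of the theorem *)

Lemma all_fset2 (a : pred word) p q : all a [fset p; q]%fset = a p && a q.
Proof.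
apply/allP/andP => [H | [Hp Hq] r].
  by split; apply: H; rewrite !inE eqxx ?orbT.
by rewrite !inE => /orP[] /eqP ->.
Qed.

Lemma all_fset3 (a : pred word) p q r :
  all a [fset p; q; r]%fset = [&& a p, a q & a r].
Proof.
apply/allP/and3P => [H | [Hp Hq Hr] x].
  by split; apply: H; rewrite !inE eqxx ?orbT.
by rewrite !inE -orbA => /or3P[] /eqP ->.
Qed.

Lemma tame_increasing (Pi : {fset word}) :
    all (mem [:: p132; p213; p231; p312; p321]) Pi -> tame Pi increasing.
Proof.
move=> /allP sub; right=> s inc_s; split; last exact: increasing_maj_inv.
by apply/allP => p /sub; apply: increasing_avoids.
Qed.

Lemma tame_decreasing (Pi : {fset word}) :
    all (mem [:: p123; p132; p213; p231; p312]) Pi -> tame Pi decreasing.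
Proof.
move=> /allP sub; right=> s dec_s; split; last exact: decreasing_maj_inv.
by apply/allP => p /sub; apply: decreasing_avoids.
Qed.

Lemma family_maj (Pi : {fset word}) c0 c1 hi lo :
    all (fun p => 1 < size p) Pi -> tame Pi c0 -> tame Pi c1 ->
    (forall n, last_letter_rule Pi n (hi n) (lo n)) ->
    (forall n w, w \in Sym n ->
       avoids_all Pi (append (hi n w) w) = avoids_all Pi w && c0 w) ->
    (forall n w, w \in Sym n ->
       avoids_all Pi (append (lo n w) w) = avoids_all Pi w && c1 w) ->
  family maj Pi c0 c1.
Proof.
move=> Pi2 tm0 tm1 rule P0 P1; split=> // n n_gt0.
exists (fun w => append (hi n w) w), (fun w => append (lo n w) w).
by apply: grows_maj => // w w_n; [apply: P0 | apply: P1].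
Qed.

Lemma family_inv (Pi : {fset word}) c0 c1 (f0 f1 : nat -> word -> word) :
    all (fun p => 1 < size p) Pi -> tame Pi c0 -> tame Pi c1 ->
    (forall n, (p132 \in Pi /\ f0 n = append n.+1) \/
               (p213 \in Pi /\ f0 n = prepend 1)) ->
    (forall n, (p312 \in Pi /\ f1 n = append 1) \/
               (p231 \in Pi /\ f1 n = prepend n.+1)) ->
    (forall n w, w \in Sym n ->
       avoids_all Pi (f0 n w) = avoids_all Pi w && c0 w) ->
    (forall n w, w \in Sym n ->
       avoids_all Pi (f1 n w) = avoids_all Pi w && c1 w) ->
  family inv Pi c0 c1.
Proof.
move=> Pi2 tm0 tm1 f0E f1E P0 P1; split=> // n n_gt0.
exists (f0 n), (f1 n).
by apply: grows_inv => // w w_n; [apply: P0 | apply: P1].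
Qed.

(** The lemmas below differ only in the insertions chosen for each set of
    patterns; [maj_family] and [inv_family] check the hypotheses of
    [family_maj] and [family_inv] for the given choice.  A set that contains
    two patterns which determine the same insertion leaves a choice; it is made
    so that every pattern of the set either is harmless to an insertion or
    restricts it to monotone words. *)
Ltac solve_tame :=
  first [ by left
        | by apply: tame_increasing; rewrite ?all_fset2 ?all_fset3
        | by apply: tame_decreasing; rewrite ?all_fset2 ?all_fset3 ].

Ltac solve_choice :=
  first [ by left; split; rewrite ?inE | by right; split; rewrite ?inE ].

Ltac solve_step :=
  let n := fresh in let w := fresh in let w_n := fresh in
  move=> n w w_n; rewrite /avoids_all !(all_fset2, all_fset3);
  rewrite ?(avoids_append_top w_n) ?(avoids_append_bottom w_n)
    ?(avoids_prepend_top w_n) ?(avoids_prepend_bottom w_n)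
    ?(avoids_append_above_last w_n) ?(avoids_append_last w_n);
  (* The syntactic matching of [destruct] keeps unification from comparing
     avoidance of two different patterns by computation. *)
  repeat match goal with |- context [avoids w ?p] =>
    let av := fresh in destruct (avoids w p) eqn:av;
    rewrite ?andbF ?andbT /= ?andbT //
  end;
  rewrite ?(avoids_append_above_last_p123 w_n) //;
  rewrite ?(avoids_append_last_p321 w_n) //;
  repeat match goal with H : avoids w ?p = _ |- context [avoids w ?p] =>
    rewrite H /= ?andbT //
  end.

Ltac maj_family hi lo :=
  apply: (@family_maj _ _ _ hi lo);
  [ by rewrite ?all_fset2 ?all_fset3 | solve_tame | solve_tame
  | by move=> n; split; solve_choice | solve_step | solve_step ].

Ltac inv_family f0 f1 :=
  apply: (@family_inv _ _ _ f0 f1);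
  [ by rewrite ?all_fset2 ?all_fset3 | solve_tame | solve_tame
  | by move=> n; solve_choice | by move=> n; solve_choice
  | solve_step | solve_step ].

Definition top n (w : word) := n.+1.
Definition bottom (n : nat) (w : word) := 1.
Definition above_last (n : nat) (w : word) := (last 0 w).+1.
Definition at_last (n : nat) (w : word) := last 0 w.

Local Open Scope fset_scope.

Lemma maj_unrestricted Pi :
    Pi \in [:: [fset p132; p213]; [fset p132; p312];
               [fset p213; p231]; [fset p231; p312]] ->
  family maj Pi predT predT.
Proof.
rewrite !inE => /or4P[] /eqP ->.
- maj_family above_last bottom.
- maj_family top bottom.
- maj_family above_last at_last.
- maj_family top at_last.
Qed.

Lemma maj_descent_if_decreasing Pi :
    Pi \in [:: [fset p132; p213; p231]; [fset p132; p231; p312]] ->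
  family maj Pi predT decreasing.
Proof.
rewrite !inE => /orP[] /eqP ->.
- maj_family above_last bottom.
- maj_family top bottom.
Qed.

Lemma maj_ascent_if_increasing Pi :
    Pi \in [:: [fset p132; p213; p312]; [fset p213; p231; p312]] ->
  family maj Pi increasing predT.
Proof.
rewrite !inE => /orP[] /eqP ->.
- maj_family top bottom.
- maj_family top at_last.
Qed.

Lemma maj_ascent_if_decreasing Pi :
    Pi \in [:: [fset p123; p132; p312]; [fset p123; p213; p231];
               [fset p123; p231; p312]] ->
  family maj Pi decreasing predT.
Proof.
rewrite !inE => /or3P[] /eqP ->.
- maj_family top bottom.
- maj_family above_last at_last.
- maj_family top at_last.
Qed.

Lemma maj_descent_if_increasing Pi :
    Pi \in [:: [fset p132; p213; p321]; [fset p132; p312; p321];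
               [fset p213; p231; p321]] ->
  family maj Pi predT increasing.
Proof.
rewrite !inE => /or3P[] /eqP ->.
- maj_family above_last bottom.
- maj_family top bottom.
- maj_family above_last at_last.
Qed.

Definition append_top n := append n.+1.
Definition append_bottom (n : nat) := append 1.
Definition prepend_top n := prepend n.+1.
Definition prepend_bottom (n : nat) := prepend 1.

Lemma inv_unrestricted Pi :
    Pi \in [:: [fset p132; p231]; [fset p132; p312];
               [fset p213; p231]; [fset p213; p312]] ->
  family inv Pi predT predT.
Proof.
rewrite !inE => /or4P[] /eqP ->.
- inv_family append_top prepend_top.
- inv_family append_top append_bottom.
- inv_family prepend_bottom prepend_top.
- inv_family prepend_bottom append_bottom.
Qed.

Lemma inv_raise_if_decreasing Pi :
    Pi \in [:: [fset p132; p231; p312]; [fset p213; p231; p312]] ->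
  family inv Pi predT decreasing.
Proof.
rewrite !inE => /orP[] /eqP ->.
- inv_family append_top prepend_top.
- inv_family prepend_bottom append_bottom.
Qed.

Lemma inv_keep_if_increasing Pi :
    Pi \in [:: [fset p132; p213; p231]; [fset p132; p213; p312]] ->
  family inv Pi increasing predT.
Proof.
rewrite !inE => /orP[] /eqP ->.
- inv_family append_top prepend_top.
- inv_family append_top append_bottom.
Qed.

Lemma inv_keep_if_decreasing Pi :
    Pi \in [:: [fset p123; p132; p231]; [fset p123; p132; p312];
               [fset p123; p213; p231]; [fset p123; p213; p312]] ->
  family inv Pi decreasing predT.
Proof.
rewrite !inE => /or4P[] /eqP ->.
- inv_family append_top prepend_top.
- inv_family append_top append_bottom.
- inv_family prepend_bottom prepend_top.
- inv_family prepend_bottom append_bottom.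
Qed.

Lemma inv_raise_if_increasing Pi :
    Pi \in [:: [fset p132; p231; p321]; [fset p132; p312; p321];
               [fset p213; p231; p321]; [fset p213; p312; p321]] ->
  family inv Pi predT increasing.
Proof.
rewrite !inE => /or4P[] /eqP ->.
- inv_family append_top prepend_top.
- inv_family append_top append_bottom.
- inv_family prepend_bottom prepend_top.
- inv_family prepend_bottom append_bottom.
Qed.

Theorem theorem8p3 (Pi Pi' : {fset word})
  (H :
     (Pi  \in [:: [fset p132; p213];
               [fset p132; p312];
               [fset p213; p231];
               [fset p231; p312]] /\
      Pi' \in [:: [fset p132; p231];
               [fset p132; p312];
               [fset p213; p231];
               [fset p213; p312]]) \/
     (Pi  \in [:: [fset p132; p213; p231];
               [fset p132; p231; p312]] /\
      Pi' \in [:: [fset p132; p231; p312];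
               [fset p213; p231; p312]]) \/
     (Pi  \in [:: [fset p132; p213; p312];
               [fset p213; p231; p312]] /\
      Pi' \in [:: [fset p132; p213; p231];
               [fset p132; p213; p312]]) \/
     (Pi  \in [:: [fset p123; p132; p312];
               [fset p123; p213; p231];
               [fset p123; p231; p312]] /\
      Pi' \in [:: [fset p123; p132; p231];
               [fset p123; p132; p312];
               [fset p123; p213; p231];
               [fset p123; p213; p312]]) \/
     (Pi  \in [:: [fset p132; p213; p321];
               [fset p132; p312; p321];
               [fset p213; p231; p321]] /\
      Pi' \in [:: [fset p132; p231; p321];
               [fset p132; p312; p321];
               [fset p213; p231; p321];
               [fset p213; p312; p321]]))
  (n : nat) :
  mahonian_pair (Av n Pi) (Av n Pi').
Proof.
case: H => [|[|[|[|]]]] [/[swap]].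
- move=> /inv_unrestricted inv_Pi' /maj_unrestricted maj_Pi.
  exact: family_mahonian maj_Pi inv_Pi' n.
- move=> /inv_raise_if_decreasing inv_Pi' /maj_descent_if_decreasing maj_Pi.
  exact: family_mahonian maj_Pi inv_Pi' n.
- move=> /inv_keep_if_increasing inv_Pi' /maj_ascent_if_increasing maj_Pi.
  exact: family_mahonian maj_Pi inv_Pi' n.
- move=> /inv_keep_if_decreasing inv_Pi' /maj_ascent_if_decreasing maj_Pi.
  exact: family_mahonian maj_Pi inv_Pi' n.
move=> /inv_raise_if_increasing inv_Pi' /maj_descent_if_increasing maj_Pi.
exact: family_mahonian maj_Pi inv_Pi' n.
Qed.
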